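(* Let $n,\tilde n\in\left(\mathbb{C}\bmod\frac{2\pi i}{\log q}\mathbb{Z}\right)^d$, $z,\tilde z\in(\mathbb{C}\setminus\{0\})^d$ and $\alpha,\tilde\alpha\in(\mathbb{C}\setminus\{0\})^{d+3}$ be related by $$q^{\tilde n_j}=\frac{\alpha_{d+1-j}z_{d+1-j}}{\alpha_{d+2-j}z_{d+2-j}},\qquad \tilde z_j=\frac{\alpha_{d+2-j}}{\alpha_0}q^{N_{d+1-j}-1/2}\qquad (j=1,\dots,d),$$ $$\tilde\alpha_0=\alpha_0,\qquad \tilde\alpha_j=\frac{\alpha_0\alpha_{d+1}\alpha_{d+2}}{\alpha_{d+2-j}}q^{1/2}\quad(j=1,\dots,d+1),\qquad \tilde\alpha_{d+2}=\frac{\alpha_1}{\alpha_0}q^{-1/2},$$ where $z_{d+1}=\alpha_{d+2}$ and $N_k=n_1+\cdots+n_k$. Put $x_j=\frac12(z_j+z_j^{-1})$ and $\tilde x_j=\frac12(\tilde z_j+\tilde z_j^{-1})$. If $n,\tilde n\in\mathbb{N}_0^d$, then the normalized multivariable Askey-Wilson polynomials satisfy $$\hat P_d(n;x;\alpha)=\hat P_d(\tilde n;\tilde x;\tilde\alpha).$$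
   Context: Fix $q\in(0,1)$ and an integer $d\ge 1$. Put $(a;q)_n=\prod_{k=0}^{n-1}(1-aq^k)$, $(a_1,\dots,a_k;q)_n=\prod_{j}(a_j;q)_n$, and $${}_4\phi_3\left[\begin{matrix}a_1,a_2,a_3,a_4\\ b_1,b_2,b_3\end{matrix};q,q\right]=\sum_{m\ge0}\frac{(a_1,a_2,a_3,a_4;q)_m}{(q,b_1,b_2,b_3;q)_m}q^m.$$ Askey-Wilson polynomials: with $x=\frac12(z+z^{-1})$, $$p_n(x;a,b,c,e)=\frac{(ab,ac,ae;q)_n}{a^n}\,{}_4\phi_3\left[\begin{matrix}q^{-n},\,abce\,q^{n-1},\,az,\,az^{-1}\\ ab,\,ac,\,ae\end{matrix};q,q\right]$$ (after multiplying out the prefactor this is a polynomial expression in $x$, defined for all $a\neq0$, $b,c,e$). Multivariable Askey-Wilson polynomials: for $n\in\mathbb{N}_0^d$, $x_j=\frac12(z_j+z_j^{-1})$, $z_{d+1}=\alpha_{d+2}$, $N_k=n_1+\cdots+n_k$, $N_0=0$, $$P_d(n;x;\alpha)=\prod_{j=1}^{d}p_{n_j}\left(x_j;\alpha_jq^{N_{j-1}},\frac{\alpha_j}{\alpha_0^2}q^{N_{j-1}},\frac{\alpha_{j+1}}{\alpha_j}z_{j+1},\frac{\alpha_{j+1}}{\alpha_j}z_{j+1}^{-1}\right).$$ Normalization: with $|n|=n_1+\cdots+n_d$, $$\hat P_d(n;x;\alpha)=\frac{(\alpha_{d+1}\alpha_{d+2})^{|n|}\,P_d(n;x;\alpha)}{(\alpha_{d+1}\alpha_{d+2},\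 \alpha_{d+1}\alpha_{d+2}/\alpha_0^2;q)_{|n|}\prod_{j=1}^d\alpha_j^{n_j}(\alpha_{j+1}^2/\alpha_j^2;q)_{n_j}}.$$ The parameters are understood to be such that the normalizing denominators of both $\hat P_d(n;x;\alpha)$ and $\hat P_d(\tilde n;\tilde x;\tilde\alpha)$ are nonzero. The variables $n_j$ are complex numbers modulo $\frac{2\pi i}{\log q}\mathbb{Z}$ because $q^{n_j}$ determines $n_j$ only modulo this lattice; $n\in\mathbb{N}_0^d$ means that the class has a representative in $\mathbb{N}_0^d$. *)

(* Defs.v *)
From HB Require Import structures.
From mathcomp Require Import all_boot all_order all_algebra.
From mathcomp Require Import complex.
From mathcomp Require Import reals.
From mathcomp Require Import sequences exp trigo.
From mathcomp Require Import ring.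

Set Implicit Arguments.
Unset Strict Implicit.
Unset Printing Implicit Defensive.

Import Order.TTheory GRing.Theory Num.Theory.
Local Open Scope ring_scope.

(* One-based access to a tuple (v_1, ..., v_d); only meaningful for
   1 <= j <= d.  The parameter tuple alpha = (alpha_0, ..., alpha_{d+2}) is
   zero-based and accessed with the library notation alpha`_j. *)
Definition coord (V : nmodType) (v : seq V) (j : nat) : V := v`_j.-1.
Notation "v @_ j" := (coord v j)
  (at level 3, j at level 2, left associativity, format "v @_ j").

(* N_k = n_1 + ... + n_k *)
Definition psum (V : nmodType) (n : seq V) (k : nat) : V :=
  \sum_(1 <= i < k.+1) n@_i.

Section Polynomials.
Variable F : fieldType.
Implicit Types q a b c e : F.

Definition qpoch q a (n : nat) : F := \prod_(k < n) (1 - a * q ^+ k).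

Definition phi43_term q (a1 a2 a3 a4 b1 b2 b3 : F) (m : nat) : F :=
  qpoch q a1 m * qpoch q a2 m * qpoch q a3 m * qpoch q a4 m
  / (qpoch q q m * qpoch q b1 m * qpoch q b2 m * qpoch q b3 m) * q ^+ m.

(* p_n(x; a, b, c, e) at x = (z + 1/z)/2, with the prefactor (ab, ac, ae; q)_n
   multiplied into the terminating 4phi3, by means of
   (ab; q)_n / (ab; q)_m = (ab q^m; q)_(n-m); see askey_wilson_zE. *)
Definition askey_wilson_z q (n : nat) (z : F) a b c e : F :=
  a ^- n * \sum_(0 <= m < n.+1)
    qpoch q (q ^- n) m * qpoch q (a * b * c * e * q ^+ n / q) m
    * qpoch q (a * z) m * qpoch q (a / z) m / qpoch q q m * q ^+ m
    * (qpoch q (a * b * q ^+ m) (n - m) * qpoch q (a * c * q ^+ m) (n - m)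
       * qpoch q (a * e * q ^+ m) (n - m)).

Section Multivariable.
Variable d : nat.
Implicit Types (n : d.-tuple nat) (z : d.-tuple F) (alpha : d.+3.-tuple F).

(* (z_1, ..., z_d, z_{d+1}) with z_{d+1} = alpha_{d+2} *)
Definition zext z alpha : seq F := rcons z alpha`_d.+2.

Definition mAW_z q n z alpha : F :=
  let zz := zext z alpha in
  \prod_(1 <= j < d.+1)
    askey_wilson_z q n@_j zz@_j
      (alpha`_j * q ^+ psum n j.-1)
      (alpha`_j / alpha`_0 ^+ 2 * q ^+ psum n j.-1)
      (alpha`_j.+1 / alpha`_j * zz@_j.+1)
      (alpha`_j.+1 / alpha`_j * (zz@_j.+1)^-1).

Definition mAW_denom q n alpha : F :=
  let A := alpha`_d.+1 * alpha`_d.+2 in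
  qpoch q A (psum n d) * qpoch q (A / alpha`_0 ^+ 2) (psum n d)
  * \prod_(1 <= j < d.+1)
      (alpha`_j ^+ n@_j * qpoch q (alpha`_j.+1 ^+ 2 / alpha`_j ^+ 2) n@_j).

End Multivariable.
End Polynomials.

Definition half_sum (F : fieldType) (z : F) : F := (z + z^-1) / 2.

Section FunctionOfX.
Variable C : numClosedFieldType.

(* A choice of z with x = (z + 1/z)/2; by mAW_half_sum the choice of root is
   irrelevant. *)
Definition zof (x : C) : C := x + sqrtC (x ^+ 2 - 1).

Definition mAW d (q : C) (n : d.-tuple nat) (x : d.-tuple C)
    (alpha : d.+3.-tuple C) : C :=
  mAW_z q n (map_tuple zof x) alpha.

Definition mAW_hat d (q : C) (n : d.-tuple nat) (x : d.-tuple C)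
    (alpha : d.+3.-tuple C) : C :=
  (alpha`_d.+1 * alpha`_d.+2) ^+ psum n d * mAW q n x alpha
  / mAW_denom q n alpha.

End FunctionOfX.

Section ComplexPower.
Variable R : realType.
Local Open Scope complex_scope.

(* q^w = exp (w log q) for q > 0 and complex w *)
Definition cpow (q : R) (w : R[i]) : R[i] :=
  (expR (complex.Re w * ln q))%:C
  * (cos (complex.Im w * ln q) +i* sin (complex.Im w * ln q)).

(* congruence modulo (2 pi i / log q) Z *)
Definition eqmod_period (q : R) (w w' : R[i]) : Prop :=
  exists k : int, w - w' = k%:~R * (2 * pi%:C * 'i / (ln q)%:C).

End ComplexPower.

Lemma qpochD (F : fieldType) (q a : F) m n :
  qpoch q a (m + n) = qpoch q a m * qpoch q (a * q ^+ m) n.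
Proof.
rewrite /qpoch big_split_ord /=; congr (_ * _).
by apply: eq_bigr => i _; rewrite exprD mulrA.
Qed.

(* Every partial sum of the 4phi3 series with more than n terms gives p_n. *)
Lemma askey_wilson_zE (F : fieldType) (q : F) n M (z a b c e : F) :
    q != 0 -> (n <= M)%N ->
    qpoch q (a * b) n != 0 -> qpoch q (a * c) n != 0 ->
    qpoch q (a * e) n != 0 ->
  askey_wilson_z q n z a b c e =
  qpoch q (a * b) n * qpoch q (a * c) n * qpoch q (a * e) n / a ^+ n
  * \sum_(0 <= m < M.+1)
      phi43_term q (q ^- n) (a * b * c * e * q ^+ n / q) (a * z) (a / z)
        (a * b) (a * c) (a * e) m.
Proof.
move=> q0 nM hb hc he.
rewrite (big_cat_nat (n := n.+1)) //= [X in _ + X]big_nat_cond.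
rewrite [X in _ + X]big1 ?addr0; last first.
  move=> m /andP[/andP[nm _] _]; rewrite /phi43_term.
  suff -> : qpoch q (q ^- n) m = 0 by rewrite !mul0r.
  rewrite /qpoch (bigD1 (Ordinal nm)) //= mulVf ?expf_neq0 //.
  by rewrite subrr mul0r.
rewrite /askey_wilson_z -[RHS]mulrA [RHS]mulrCA; congr (_ * _).
rewrite mulr_sumr !big_nat; apply: eq_bigr => m /andP[_]; rewrite ltnS => mn.
have key u : qpoch q u n != 0 ->
    qpoch q (u * q ^+ m) (n - m) = qpoch q u n / qpoch q u m.
  rewrite -{1 3}(subnKC mn) qpochD mulf_eq0 negb_or => /andP[h _].
  by rewrite mulrAC mulfV ?mul1r.
rewrite !key // /phi43_term !invfM.
move: (qpoch q q m)^-1 (qpoch q (a * b) m)^-1 (qpoch q (a * c) m)^-1.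
move: (qpoch q (a * e) m)^-1 => i1 i2 i3 i4; ring.
Qed.

Lemma askey_wilson_zV (F : fieldType) (q : F) n (z a b c e : F) :
  askey_wilson_z q n z^-1 a b c e = askey_wilson_z q n z a b c e.
Proof.
rewrite /askey_wilson_z invrK; congr (_ * _); apply: eq_bigr => m _.
by congr (_ / _ * _ * _); rewrite mulrAC.
Qed.

Lemma askey_wilson_zC (F : fieldType) (q : F) n (z a b c e : F) :
  askey_wilson_z q n z a b e c = askey_wilson_z q n z a b c e.
Proof.
rewrite /askey_wilson_z; congr (_ * _); apply: eq_bigr => m _.
by rewrite [a * b * e * c]mulrAC [_ * qpoch q (a * e * _) _ * _]mulrAC.
Qed.

Lemma zofP (C : numClosedFieldType) (z : C) :
  z != 0 -> zof (half_sum z) = z \/ zof (half_sum z) = z^-1.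
Proof.
move=> z0; rewrite /zof; set x := half_sum z; set s := sqrtC _.
have hs : s ^+ 2 = x ^+ 2 - 1 by rewrite sqrtCK.
have hx : 2 * x = z + z^-1 by rewrite mulrC divfK ?pnatr_eq0.
have : (x + s - z) * (x + s - z^-1) = 0.
  have -> : (x + s - z) * (x + s - z^-1) =
    x ^+ 2 + 2 * x * s + s ^+ 2 - (x + s) * (z + z^-1) + z * z^-1 by ring.
  by rewrite hs -hx mulfV //; ring.
by move=> /eqP; rewrite mulf_eq0 !subr_eq0 => /orP[] /eqP; [left|right].
Qed.

Lemma mAW_half_sum (C : numClosedFieldType) d (q : C) (n : d.-tuple nat)
    (z : d.-tuple C) (alpha : d.+3.-tuple C) :
    (forall j, (1 <= j <= d)%N -> z@_j != 0) ->
  mAW q n [tuple of [seq half_sum w | w <- z]] alpha = mAW_z q n z alpha.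
Proof.
move=> z0; rewrite /mAW /mAW_z /=.
set z' := map_tuple _ _.
have zz k : (zext z' alpha)`_k = (zext z alpha)`_k \/
            (zext z' alpha)`_k = ((zext z alpha)`_k)^-1.
  rewrite /zext !nth_rcons !size_tuple.
  case: ltnP => [kd|_]; last by left.
  rewrite !(nth_map 0) ?size_map ?size_tuple //.
  exact: zofP (z0 k.+1 kd).
rewrite !big_nat; apply: eq_bigr => j _; rewrite /coord.
case: (zz j.-1) => ->; case: (zz j.+1.-1) => ->;
  by rewrite ?askey_wilson_zV ?invrK // askey_wilson_zC.
Qed.

Section ComplexPowerFacts.
Variable R : realType.
Local Open Scope complex_scope.

Lemma cpowD (q : R) (w w' : R[i]) : cpow q (w + w') = cpow q w * cpow q w'.
Proof.
case: w w' => [a b] [a' b'].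
rewrite /cpow /= !mulrDl expRD cosD sinD.
by apply/eqP; rewrite eq_complex /=; apply/andP; split; apply/eqP; ring.
Qed.

Lemma cpow_nat (q : R) (m : nat) : 0 < q -> cpow q m%:R = q%:C ^+ m.
Proof.
move=> q0; elim: m => [|m IH].
  by rewrite /cpow /= !mul0r expR0 cos0 sin0 mulr1.
rewrite -natr1 cpowD IH exprSr; congr (_ * _).
by rewrite /cpow /= mul1r mul0r cos0 sin0 lnK ?posrE // mulr1.
Qed.

Lemma cpow_eqmod (q : R) (w w' : R[i]) :
  0 < q -> q < 1 -> eqmod_period q w w' -> cpow q w = cpow q w'.
Proof.
move=> q0 q1 [k hk].
have lq : ln q != 0 by rewrite lt_eqF // ln_lt0 // q0.
pose t : R[i] := 2 * pi%:C * 'i / (ln q)%:C.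
have ht : t = 0 +i* (pi *+ 2 / ln q).
  rewrite /t -fmorphV -(rmorph_nat (real_complex R) 2).
  by apply/eqP; rewrite eq_complex /=; apply/andP; split; apply/eqP; ring.
have h1 : cpow q t = 1.
  by rewrite /cpow ht /= mul0r expR0 divfK // cos2pi sin2pi mulr1.
have hn m : cpow q (m%:R * t) = 1.
  elim: m => [|m IH]; first by rewrite mul0r (cpow_nat 0).
  by rewrite -natr1 mulrDl mul1r cpowD IH h1 mulr1.
have -> : w = w' + k%:~R * t by rewrite /t -hk addrC subrK.
rewrite cpowD; suff -> : cpow q (k%:~R * t) = 1 by rewrite mulr1.
case: k {hk} => m; first exact: hn.
have := cpowD q ((Negz m)%:~R * t) (m.+1%:R * t).
by rewrite hn mulr1 -mulrDl NegzE rmorphN /= addNr mul0r (cpow_nat 0).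
Qed.

End ComplexPowerFacts.

(* Main.v *)
(* Put [A = alpha_(d+1) alpha_(d+2)] and write N', n' for the dual degrees.  The
   relations say [alpha_j z_j = A q^(N'_(d+1-j))].  By Sears' transformation the
   Askey-Wilson polynomial p_n(x; a,b,c,e) is symmetric in its parameters; in the
   j-th factor take [c = alpha_(j+1) z_(j+1) / alpha_j] as the distinguished one.
   Then [z_j / c = q^(n'_(d+1-j))], so the numerator parameters of the 4phi3 are
   [q^-n_j], [q^-n'_(d+1-j)] and two more, and the duality exchanges both pairs
   and fixes the denominator parameters.  What remains are prefactors, which
   telescope over j.  Since [(A; q)_k] may vanish for large k, they are compared
   term by term after expanding the product of the (multiplied out) sums. *)

Require Import Defs.
From mathcomp Require Import all_boot all_order all_algebra.
From mathcomp Require Import complex.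
From mathcomp Require Import reals.
From mathcomp Require Import sequences exp trigo.
From mathcomp Require Import ring.

Import Order.TTheory GRing.Theory Num.Theory.
Local Open Scope ring_scope.
Local Open Scope complex_scope.

(** * Recurrences for q-shifted factorials *)

Lemma qpoch0 {F : fieldType} (q a : F) : qpoch q a 0 = 1.
Proof. by rewrite /qpoch big_ord0. Qed.

Lemma qpochSr {F : fieldType} (q a : F) k :
  qpoch q a k.+1 = qpoch q a k * (1 - a * q ^+ k).
Proof. by rewrite /qpoch big_ord_recr. Qed.

Lemma qpochS {F : fieldType} (q a : F) k :
  qpoch q a k.+1 = (1 - a) * qpoch q (a * q) k.
Proof. by rewrite -add1n qpochD qpochSr qpoch0 mul1r expr0 mulr1 expr1. Qed.

Lemma qpochqS {F : fieldType} (q a : F) i k :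
  qpoch q (a * q ^+ i) k.+1 = (1 - a * q ^+ i) * qpoch q (a * q ^+ i.+1) k.
Proof. by rewrite qpochS -mulrA -exprSr. Qed.

Lemma qpochqq_neq0 {F : fieldType} (q : F) k :
  (forall i, q ^+ i.+1 != 1) -> qpoch q q k != 0.
Proof.
move=> q1; rewrite /qpoch; apply/prodf_neq0 => i _.
by rewrite -exprS subr_eq0 eq_sym.
Qed.

(** * Two summation formulas, proved by telescoping *)

(** The q-Saalschuetz sum of a balanced terminating 3phi2, with [(C, D; q)_k] multiplied in so that
    zeros of the denominators are harmless. Induction on [k]: the sums for [(k + 1, C, D)] and
    [(k, C q, D q)] are proportional. *)
Lemma q_saalschutz {F : fieldType} (q : F) k (B C D : F) :
    q != 0 -> (forall i, q ^+ i.+1 != 1) -> B != 0 ->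
  \sum_(i < k.+1) qpoch q (q ^- k) i * qpoch q (C * D / B * q ^+ k / q) i
     * qpoch q B i / qpoch q q i * q ^+ i
     * (qpoch q (C * q ^+ i) (k - i) * qpoch q (D * q ^+ i) (k - i)) =
  B ^+ k * qpoch q (C / B) k * qpoch q (D / B) k.
Proof.
move=> q0 q1 B0; elim: k C D => [|k IH] C D.
  by rewrite big_ord1 /= !qpoch0 !mulr1 divr1.
set A := C * D / B * q ^+ k.
have eA : C * D / B * q ^+ k.+1 / q = A by rewrite exprSr mulrA mulfK.
have eA' : C * q * (D * q) / B * q ^+ k / q = A * q.
  by rewrite /A; field; rewrite q0 B0.
have yq0 : q ^+ k != 0 by rewrite expf_neq0.
pose K := (B - C) * (1 - D / B).
pose t i := qpoch q (q ^- k.+1) i * qpoch q A i * qpoch q B i / qpoch q q i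
  * q ^+ i * (qpoch q (C * q ^+ i) (k.+1 - i) * qpoch q (D * q ^+ i) (k.+1 - i)).
pose t' i := qpoch q (q ^- k) i * qpoch q (A * q) i * qpoch q B i / qpoch q q i
  * q ^+ i * (qpoch q (C * q * q ^+ i) (k - i) * qpoch q (D * q * q ^+ i) (k - i)).
(* Wilf-Zeilberger certificate: [t i - K * t' i = H i - H (i - 1)]. *)
pose H i := qpoch q (q ^- k) i * qpoch q (A * q) i * qpoch q B i.+1
  / qpoch q q i * (1 - q ^- k.+1 * A * q ^+ i.+1)
  * (qpoch q (C * q ^+ i.+1) (k - i) * qpoch q (D * q ^+ i.+1) (k - i)).
have pq : q ^- k.+1 * q = q ^- k by rewrite exprSr invfM mulfVK.
have qq i : 1 - q * q ^+ i != 0 by rewrite -exprS subr_eq0 eq_sym.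
have Hm i : (i <= k)%N ->
    \sum_(j < i.+1) t j = K * (\sum_(j < i.+1) t' j) + H i.
  elim: i => [|i IHi] ik.
    rewrite !big_ord1 /t /t' /H /K !subn0 (qpochSr q B) !qpoch0 !expr0 !mulr1 expr1.
    rewrite [qpoch _ C _]qpochS [qpoch _ D _]qpochS /A exprSr.
    move: (q ^+ k) yq0 (qpoch _ (C * q) k) (qpoch _ (D * q) k) => y y0 u v.
    by field; rewrite oner_eq0 y0 q0 B0.
  rewrite big_ord_recr (IHi (ltnW ik)) [in RHS]big_ord_recr /=.
  rewrite mulrDr -!addrA; congr (_ + _).
  rewrite /t /t' /H /K ?subSS.
  have [M eM] : exists M, (k - i)%N = M.+1 by exists (k - i.+1)%N; rewrite subnSK.
  have -> : (k - i.+1 = M)%N by rewrite subnS eM.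
  (* Peeling single factors off the factorials leaves common blocks, which become atoms for
     [field]. *)
  rewrite eM !(qpochqS q C) !(qpochqS q D) -!(mulrA C q) -!(mulrA D q) -!exprS.
  rewrite [qpoch _ (q ^- k.+1) _]qpochS [qpoch _ A _]qpochS pq.
  rewrite !(qpochSr q (q ^- k)) !(qpochSr q (A * q)) !(qpochSr q B) !(qpochSr q q).
  move: (qpochqq_neq0 q i q1) (qq i); rewrite !exprS /A.
  move: (q ^+ k) yq0 (q ^+ i) => y y0 x.
  move: (qpoch q q i) (qpoch q B i) (qpoch q _ i) (qpoch q _ i).
  move: (qpoch _ _ M) (qpoch _ _ M) => u v g1 g2 g3 g4 hg hq.
  by field; rewrite ?oner_eq0 y0 q0 B0 hg hq.
(* The top term [t k.+1] has no counterpart in [t']; it cancels [H k]. *)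
have last : t k.+1 + H k = 0.
  rewrite /t /H !subnn !qpoch0 !mulr1.
  rewrite [qpoch _ (q ^- k.+1) _]qpochS [qpoch _ A _]qpochS pq.
  rewrite !(qpochSr q B) !(qpochSr q q).
  move: (qpochqq_neq0 q k q1) (qq k); rewrite !exprS /A.
  move: (q ^+ k) yq0 => y y0.
  move: (qpoch q q k) (qpoch q B k) (qpoch q _ k) (qpoch q _ k) => g1 g2 g3 g4 hg hq.
  by field; rewrite ?oner_eq0 y0 q0 B0 hg hq.
transitivity (\sum_(i < k.+2) t i); first by rewrite eA.
rewrite big_ord_recr (Hm k (leqnn k)) /= -addrA [H k + _]addrC last addr0.
have -> : \sum_(j < k.+1) t' j =
    B ^+ k * qpoch q (C * q / B) k * qpoch q (D * q / B) k.
  by rewrite -IH eA'.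
rewrite !qpochS /K exprS ![_ / B * q]mulrAC.
move: (qpoch _ _ k) (qpoch _ _ k) (B ^+ k) => u v w.
by field.
Qed.

(** With [A = c z], [B = c / z] and [w = a / c] this expands [(a z, a / z; q)_k] in the products
    [(c z, c / z; q)_i]. The induction shifts [w] to [w q]. *)
Lemma qpoch_connection {F : fieldType} (q w A B : F) k :
    (forall i, q ^+ i.+1 != 1) ->
  \sum_(i < k.+1) qpoch q q k / (qpoch q q i * qpoch q q (k - i)) * w ^+ i
     * (qpoch q A i * qpoch q B i)
     * (qpoch q (w * A * B * q ^+ i) (k - i) * qpoch q w (k - i)) =
  qpoch q (w * A) k * qpoch q (w * B) k.
Proof.
move=> q1; elim: k w => [|k IH] w.
  by rewrite big_ord1 /= !qpoch0 !mulr1 divr1.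
pose K := (1 - w * A) * (1 - w * B).
pose t i := qpoch q q k.+1 / (qpoch q q i * qpoch q q (k.+1 - i)) * w ^+ i
     * (qpoch q A i * qpoch q B i)
     * (qpoch q (w * A * B * q ^+ i) (k.+1 - i) * qpoch q w (k.+1 - i)).
pose t' i := qpoch q q k / (qpoch q q i * qpoch q q (k - i)) * (w * q) ^+ i
     * (qpoch q A i * qpoch q B i)
     * (qpoch q (w * A * B * q ^+ i.+1) (k - i) * qpoch q (w * q) (k - i)).
(* Telescoping certificate: [t i - K * t' i = H i - H (i - 1)] for [0 < i <= k]. *)
pose H i := - (qpoch q q k / (qpoch q q i * qpoch q q (k - i)) * w ^+ i.+1
     * (qpoch q A i.+1 * qpoch q B i.+1)
     * (qpoch q (w * A * B * q ^+ i.+1) (k - i) * qpoch q (w * q) (k - i))).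
have qq i : 1 - q * q ^+ i != 0 by rewrite -exprS subr_eq0 eq_sym.
have p0 i : qpoch q q i != 0 by exact: qpochqq_neq0.
have Hm i : (i <= k)%N ->
    \sum_(j < i.+1) t j = K * (\sum_(j < i.+1) t' j) + H i.
  elim: i => [|i IHi] ik.
    rewrite !big_ord1 /t /t' /H /K !subn0 (qpochSr q A) (qpochSr q B).
    rewrite !qpoch0 !expr0 !expr1.
    rewrite !mulr1 !mul1r [qpoch _ w _]qpochS [qpoch q (w * A * B) k.+1]qpochS.
    rewrite !(mulfV (p0 _)).
    by ring.
  rewrite big_ord_recr (IHi (ltnW ik)) [in RHS]big_ord_recr /=.
  rewrite mulrDr -!addrA; congr (_ + _).
  rewrite /t /t' /H /K ?subSS.
  have [M eM] : exists M, (k - i)%N = M.+1 by exists (k - i.+1)%N; rewrite subnSK.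
  have ek : k = (M + i).+1 by rewrite -addSn -eM subnK // ltnW.
  have -> : (k - i.+1 = M)%N by rewrite subnS eM.
  rewrite eM !(qpochqS q (w * A * B)).
  rewrite [qpoch q w _]qpochS !(qpochSr q (w * q)).
  rewrite !(qpochSr q A) !(qpochSr q B) !(qpochSr q q) ek.
  move: (p0 i) (p0 M) (p0 (M + i)%N) (qq i) (qq M).
  rewrite !exprS !exprMn !exprD.
  move: (q ^+ i) (q ^+ M) (w ^+ i) => x y v.
  move: (qpoch q q i) (qpoch q q M) (qpoch q q (M + i)) (qpoch q B i).
  move: (qpoch q A i) (qpoch q (w * q) M) (qpoch q _ M).
  move=> g1 g2 g3 g4 g5 g6 g7 h1 h2 h3 h4 h5.
  by field; rewrite ?oner_eq0 h1 h2 h4 h5.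
have last : t k.+1 + H k = 0.
  rewrite /t /H !subnn !qpoch0 !mulr1.
  by rewrite !(mulfV (p0 _)) addrN.
transitivity (\sum_(i < k.+2) t i); first by [].
rewrite big_ord_recr (Hm k (leqnn k)) /= -addrA [H k + _]addrC last addr0.
have -> : \sum_(j < k.+1) t' j = qpoch q (w * q * A) k * qpoch q (w * q * B) k.
  rewrite -IH; apply: eq_bigr => i _; rewrite /t' exprS.
  by congr (_ * (qpoch _ _ _ * _)); ring.
rewrite [qpoch q (w * A) _]qpochS [qpoch q (w * B) _]qpochS /K ![w * q * _]mulrAC.
by ring.
Qed.

(** * Symmetry of the Askey-Wilson polynomial in [a] and [c] *)

Lemma big_triangle {V : nmodType} (f : nat -> nat -> V) k :
  \sum_(i < k.+1) \sum_(j < i.+1) f i j =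
  \sum_(j < k.+1) \sum_(i < (k - j).+1) f (j + i)%N j.
Proof.
elim: k => [|k IH]; first by rewrite !big_ord1 /= ?big_ord1.
rewrite big_ord_recr IH [RHS]big_ord_recr /= subnn big_ord1 addn0.
rewrite [X in _ + X]big_ord_recr /= addrA; congr (_ + _).
rewrite -big_split; apply: eq_bigr => j _ /=.
have jk : (j <= k)%N by rewrite -ltnS.
by rewrite subSn // [RHS]big_ord_recr /= addnS subnKC.
Qed.

(* Expanding [(az, a/z; q)_k] in the basis [(cz, c/z; q)_j] leaves an inner sum
   that the q-Saalschuetz formula evaluates. *)
Lemma askey_wilson_z_swap {F : fieldType} (q : F) k (z a b c e : F) :
    q != 0 -> (forall i, q ^+ i.+1 != 1) -> a != 0 -> c != 0 -> z != 0 ->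
  askey_wilson_z q k z a b c e = askey_wilson_z q k z c b a e.
Proof.
move=> q0 q1 a0 c0 z0; rewrite /askey_wilson_z !big_mkord.
have p0 i : qpoch q q i != 0 by exact: qpochqq_neq0.
set P := a * b * c * e * q ^+ k / q.
have -> : c * b * a * e * q ^+ k / q = P by rewrite /P; congr (_ * _ / _); ring.
pose w := a / c.
have w0 : w != 0 by rewrite mulf_neq0 ?invr_eq0.
have ewA : w * (c * z) = a * z by rewrite /w mulrA divfK.
have ewB : w * (c / z) = a / z by rewrite /w mulrA divfK.
have ewAB : w * (c * z) * (c / z) = c * a by rewrite /w; field; rewrite c0 z0.
pose g i := qpoch q (q ^- k) i * qpoch q P i / qpoch q q i * q ^+ i
  * (qpoch q (a * b * q ^+ i) (k - i) * qpoch q (c * a * q ^+ i) (k - i)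
     * qpoch q (a * e * q ^+ i) (k - i)).
pose h i j := qpoch q q i / (qpoch q q j * qpoch q q (i - j)) * w ^+ j
     * (qpoch q (c * z) j * qpoch q (c / z) j)
     * (qpoch q (c * a * q ^+ j) (i - j) * qpoch q w (i - j)).
transitivity (a ^- k * \sum_(i < k.+1) \sum_(j < i.+1) g i * h i j).
  congr (_ * _); apply: eq_bigr => i _; rewrite -mulr_sumr.
  have := qpoch_connection q w (c * z) (c / z) i q1.
  rewrite ewAB ewA ewB /h => ->; rewrite /g [a * c]mulrC.
  move: (qpoch q (q ^- k) i) (qpoch q P i) (qpoch q (a * z) i).
  by move: (qpoch q (a / z) i) (qpoch q q i)^-1 => *; ring.
rewrite (big_triangle (fun i j => g i * h i j)).
have -> : a ^- k = c ^- k * w ^- k.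
  by rewrite /w expr_div_n invf_div mulrA mulVf ?mul1r // expf_neq0.
rewrite -mulrA; congr (_ * _); rewrite mulr_sumr; apply: eq_bigr => -[j /= jk] _.
rewrite ltnS in jk; have ek : q ^+ k = q ^+ (k - j) * q ^+ j.
  by rewrite -exprD subnK.
pose K := qpoch q (q ^- k) j * qpoch q P j / qpoch q q j * q ^+ j * w ^+ j
  * (qpoch q (c * z) j * qpoch q (c / z) j) * qpoch q (c * a * q ^+ j) (k - j).
(* The inner sum has the shifted parameters [a b q^j] and [a e q^j]; division by [w = a / c] turns
   them into [c b q^j] and [c e q^j], as in the swapped polynomial. *)
have S := q_saalschutz q (k - j) w (a * b * q ^+ j) (a * e * q ^+ j) q0 q1 w0.
have eP : a * b * q ^+ j * (a * e * q ^+ j) / w * q ^+ (k - j) / q = P * q ^+ j.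
  rewrite /P /w ek.
  by move: (q ^+ j) (q ^+ (k - j)) => x y; field; rewrite q0 a0 c0.
rewrite eP in S.
transitivity (w ^- k * (K * (w ^+ (k - j) * qpoch q (a * b * q ^+ j / w) (k - j)
   * qpoch q (a * e * q ^+ j / w) (k - j)))).
  congr (_ * _); rewrite -S mulr_sumr; apply: eq_bigr => -[i /= ik] _.
  rewrite ltnS in ik.
  rewrite /g /h /K addKn.
  have -> : (k - (j + i) = k - j - i)%N by rewrite subnDA.
  have -> : q ^- (k - j) = q ^- k * q ^+ j.
    by rewrite ek invfM mulfVK ?expf_neq0.
  (* The [c * a] factors of [g] and [h] join into one block independent of [i], which leaves the
     inner sum. *)
  have -> : qpoch q (c * a * q ^+ j) (k - j) =
      qpoch q (c * a * q ^+ j) i * qpoch q (c * a * q ^+ (j + i)) (k - j - i).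
    by rewrite -{1}(subnKC ik) qpochD exprD mulrA.
  rewrite !(qpochD q (q ^- k)) !(qpochD q P) exprD !mulrA.
  move: (p0 (j + i)%N) (p0 i) (p0 j).
  move: (qpoch q q (j + i)) (qpoch q q i) (qpoch q q j) => u v t u0 v0 t0.
  by rewrite -!(mulrA _ (q ^+ j) (q ^+ i)); field; rewrite u0 v0 t0.
have eb x : a * x * q ^+ j / w = c * x * q ^+ j.
  by rewrite /w; field; rewrite a0 c0.
rewrite !eb /K.
have -> : w ^+ (k - j) = w ^+ k / w ^+ j.
  by rewrite -[in RHS](subnK jk) exprD mulfK ?expf_neq0.
have := expf_neq0 k w0; have := expf_neq0 j w0.
move: (w ^+ k) (w ^+ j) => x y x0 y0; field.
by rewrite x0 y0 p0.
Qed.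

(** * Partial sums of degrees and telescoping of the prefactors *)

(** Zero-based and on total functions, so that reversed indices [d - i.+1] can be used freely. *)
Definition partial (u : nat -> nat) k := (\sum_(j < k) u j)%N.

Lemma partial0 (u : nat -> nat) : partial u 0 = 0%N.
Proof. exact: big_ord0. Qed.

Lemma partialS (u : nat -> nat) k : partial u k.+1 = (partial u k + u k)%N.
Proof. exact: big_ord_recr. Qed.

Lemma partial_sub (v : nat -> nat) d i : (i < d)%N ->
  partial v (d - i) = (partial v (d - i.+1) + v (d - i.+1))%N.
Proof. by move=> id; rewrite -partialS subnSK. Qed.

(** Both sides sum [u i * v j] over [i + j + 1 < d]. They are the exponents of [q] left over on the
    two sides of the duality. *)
Lemma sum_partial_sym (u v : nat -> nat) d :
  (\sum_(i < d) partial v (d - i.+1) * u i = \sum_(i < d) partial u (d - i.+1) * v i)%N.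
Proof.
elim: d => [|d IH]; first by rewrite !big_ord0.
rewrite !big_ord_recr /= !subnn !partial0 !mul0n !addn0.
(* Passing from [d] to [d + 1] adds the antidiagonal [i + j + 1 = d]. *)
have split (s t : nat -> nat) : (\sum_(i < d) partial t (d.+1 - i.+1) * s i =
    \sum_(i < d) partial t (d - i.+1) * s i + \sum_(i < d) t (d - i.+1) * s i)%N.
  rewrite -big_split; apply: eq_bigr => -[i id] _ /=.
  by rewrite subSS partial_sub // mulnDl.
rewrite !split IH; congr addn.
rewrite (reindex_inj rev_ord_inj) /=; apply: eq_bigr => -[i id] _ /=.
by rewrite (subnSK id) (subKn (ltnW id)) mulnC.
Qed.

(* Both sides become the product of the [(A; q)_(N_j + N'_(d-j))], [0 <= j <= d],
   after multiplication by the [(A; q)_(M_i + f i)]; the latter may vanish at [A],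
   but not as polynomials in [A], so they can be cancelled there. *)
Lemma prod_qpoch_dual {F : fieldType} (q A : F) (u v : nat -> nat) d (f : nat -> nat) :
    (forall i, (i < d)%N -> (f i <= u i)%N && (f i <= v (d - i.+1)%N)%N) ->
  qpoch q A (partial v d) * \prod_(i < d)
    qpoch q (A * q ^+ (partial u i + partial v (d - i.+1) + f i)) (u i - f i) =
  qpoch q A (partial u d) * \prod_(i < d)
    qpoch q (A * q ^+ (partial u i + partial v (d - i.+1) + f i)) (v (d - i.+1)%N - f i).
Proof.
move=> hf.
pose h i : {poly F} := 1 - 'X * (q ^+ i)%:P.
pose blk s l := \prod_(i < l) h (s + i)%N.
have blkE s l : qpoch q (A * q ^+ s) l = (blk s l).[A].
  rewrite horner_prod; apply: eq_bigr => i _.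
  by rewrite !hornerE exprD mulrA.
have blk0E l : qpoch q A l = (blk 0%N l).[A] by rewrite -blkE expr0 mulr1.
have blkD s l : blk 0%N (s + l)%N = blk 0%N s * blk s l.
  by rewrite /blk big_split_ord.
have blk_neq0 l : blk 0%N l != 0.
  (* Each factor takes the value 1 at [X = 0]. *)
  apply/prodf_neq0 => i _; apply/eqP => /(congr1 (fun p => p.[0])) /eqP.
  by rewrite !hornerE subr0 oner_eq0.
pose M i := (partial u i + partial v (d - i.+1))%N.
have prodE (w : nat -> nat) : \prod_(i < d) qpoch q
    (A * q ^+ (M i + f i)) (w i - f i) =
    (\prod_(i < d) blk (M i + f i)%N (w i - f i)%N).[A].
  by rewrite horner_prod; apply: eq_bigr => i _; rewrite blkE.
rewrite (prodE u) (prodE (fun i => v (d - i.+1)%N)) !blk0E -!hornerM.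
congr (_.[A]).
pose L := \prod_(i < d) blk 0%N (M i + f i)%N.
have L0 : L != 0 by apply/prodf_neq0 => i _; exact: blk_neq0.
apply: (mulIf L0); rewrite -!mulrA -!big_split /=.
have fuse (w : nat -> nat) : (forall i, (i < d)%N -> (f i <= w i)%N) ->
    \prod_(i < d) (blk (M i + f i)%N (w i - f i)%N * blk 0%N (M i + f i)%N) =
    \prod_(i < d) blk 0%N (M i + w i)%N.
  move=> fw; apply: eq_bigr => i _.
  by rewrite mulrC -blkD -addnA subnKC ?fw.
rewrite (fuse u) => [|i /hf /andP[]//].
rewrite (fuse (fun i => v (d - i.+1)%N)) => [|i /hf /andP[]//].
(* On the left [(A; q)_(N'_d)] supplies the term [i = 0] of this product, on the right
   [(A; q)_(N_d)] supplies the term [i = d]. *)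
transitivity (\prod_(i < d.+1) blk 0%N (partial u i + partial v (d - i))%N).
  rewrite big_ord_recl /= partial0 add0n subn0; congr (_ * _).
  by apply: eq_bigr => i _; rewrite /M addnAC -partialS.
rewrite big_ord_recr /= subnn partial0 addn0 mulrC; congr (_ * _).
by apply: eq_bigr => i _; rewrite /M -addnA -partial_sub.
Qed.

(** Expanding over choice functions [f] reduces this to [prod_qpoch_dual] at [A] and at [Y]; the
    weight kills every [f] that exceeds a degree. The common cutoff [K] lets both sides range over
    the same [f]. *)
Lemma prod_sum_qpoch_dual {F : fieldType} (q A Y : F) (u v : nat -> nat) d K
    (wt : nat -> nat -> F) :
    qpoch q A (partial u d) * qpoch q Y (partial u d) != 0 ->
    qpoch q A (partial v d) * qpoch q Y (partial v d) != 0 ->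
    (forall i k, (i < d)%N -> (u i < k)%N || (v (d - i.+1)%N < k)%N -> wt i k = 0) ->
  (qpoch q A (partial u d) * qpoch q Y (partial u d))^-1 *
  \prod_(i < d) \sum_(k < K) wt i k *
    (qpoch q (A * q ^+ (partial u i + partial v (d - i.+1) + k)) (u i - k)
     * qpoch q (Y * q ^+ (partial u i + partial v (d - i.+1) + k)) (u i - k)) =
  (qpoch q A (partial v d) * qpoch q Y (partial v d))^-1 *
  \prod_(i < d) \sum_(k < K) wt i k *
    (qpoch q (A * q ^+ (partial u i + partial v (d - i.+1) + k)) (v (d - i.+1)%N - k)
     * qpoch q (Y * q ^+ (partial u i + partial v (d - i.+1) + k)) (v (d - i.+1)%N - k)).
Proof.
move=> hu hv wt0; rewrite !bigA_distr_bigA !mulr_sumr.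
apply: eq_bigr => f _; rewrite !big_split /=.
have [/forallP hf|] :=
    boolP [forall i, (f i <= u i)%N && (f i <= v (d - i.+1)%N)%N].
  (* Extension of [f] by zero to all of [nat], as [prod_qpoch_dual] expects. *)
  pose f' i := if insub i is Some o then nat_of_ord (f o) else 0%N.
  have f'E (i : 'I_d) : f' i = f i by rewrite /f' valK.
  have hf' i : (i < d)%N -> (f' i <= u i)%N && (f' i <= v (d - i.+1)%N)%N.
    by move=> id; rewrite (f'E (Ordinal id)); exact: (hf (Ordinal id)).
  have E X : qpoch q X (partial v d) * \prod_(i < d)
      qpoch q (X * q ^+ (partial u i + partial v (d - i.+1) + f i)) (u i - f i) =
    qpoch q X (partial u d) * \prod_(i < d)
      qpoch q (X * q ^+ (partial u i + partial v (d - i.+1) + f i)) (v (d - i.+1)%N - f i).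
    have := prod_qpoch_dual q X u v d f' hf'.
    by under eq_bigr => i _ do rewrite f'E; under [in RHS]eq_bigr => i _ do rewrite f'E.
  move: (E A) (E Y) hu hv.
  set a1 := \prod_(i < d) _; set a2 := \prod_(i < d) _.
  set a3 := \prod_(i < d) _; set a4 := \prod_(i < d) _.
  move: (qpoch q A (partial u d)) (qpoch q Y (partial u d)).
  move: (qpoch q A (partial v d)) (qpoch q Y (partial v d)) (\prod_(i < d) _).
  move=> x y w x' y' e1 e2; rewrite !mulf_eq0 !negb_or => /andP[h1 h2] /andP[h3 h4].
  have -> : a1 = x' * a2 / x by rewrite -e1; field.
  have -> : a3 = y' * a4 / y by rewrite -e2; field.
  by field; rewrite h1 h2 h3 h4.
case/forallPn=> i; rewrite negb_and -!ltnNge => /(wt0 i _ (ltn_ord i)) w0.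
by rewrite (bigD1 i) //= w0 !mul0r !mulr0.
Qed.

Lemma partial_leq (u : nat -> nat) d i : (i < d)%N -> (u i <= partial u d)%N.
Proof. by move=> id; rewrite /partial (bigD1 (Ordinal id)) //= leq_addr. Qed.

Lemma psumE (s : seq nat) k : psum s k = partial (nth 0%N s) k.
Proof. by rewrite /psum big_add1 big_mkord. Qed.

(** * The multivariable polynomial in self-dual form *)

Lemma qpoch_qV_eq0 {F : fieldType} (q : F) k i :
  q != 0 -> (k < i)%N -> qpoch q (q ^- k) i = 0.
Proof.
move=> q0 ki; rewrite /qpoch (bigD1 (Ordinal ki)) //=.
by rewrite mulVf ?expf_neq0 // subrr mul0r.
Qed.

(** The part of a summand that duality preserves: it is invariant under exchanging [(k, s)] with
    [(l, t)]. The factorials with bases [A] and [Y] are kept apart, since they may vanish. *)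
Definition dual_weight {F : fieldType} (q s t W : F) (k l i : nat) : F :=
  qpoch q (q ^- k) i * qpoch q (q ^- l) i * (qpoch q s i * qpoch q t i)
  / (qpoch q q i * qpoch q W i) * q ^+ i.

Lemma dual_weightC {F : fieldType} (q s t W : F) k l i :
  dual_weight q t s W l k i = dual_weight q s t W k l i.
Proof. by rewrite /dual_weight [_ * qpoch q (q ^- k) i]mulrC [qpoch q t i * _]mulrC. Qed.

Lemma dual_weight_eq0 {F : fieldType} (q s t W : F) k l i :
  q != 0 -> (k < i)%N || (l < i)%N -> dual_weight q s t W k l i = 0.
Proof.
move=> q0 /orP[h|h]; rewrite /dual_weight (qpoch_qV_eq0 q _ _ q0 h).
  by rewrite !mul0r.
by rewrite mulr0 !mul0r.
Qed.

(** Swapping [a] and [c] makes [c] the distinguished parameter; then [c / z = q^(-l)] and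
    [c z = c^2 q^l], so [k] and [l] enter alike. Only [(c e; q)_k], nonzero by assumption, is
    divided out. *)
Lemma askey_wilson_z_dual {F : fieldType} (q : F) k l K (a b c e : F) :
    q != 0 -> (forall i, q ^+ i.+1 != 1) -> a != 0 -> c != 0 ->
    qpoch q (c * e) k != 0 -> (k < K)%N ->
  askey_wilson_z q k (c * q ^+ l) a b c e =
  c ^- k * qpoch q (c * e) k *
  \sum_(i < K) dual_weight q (a * b * c * e * q ^+ k / q) (c ^+ 2 * q ^+ l)
      (c * e) k l i
    * (qpoch q (c * a * q ^+ i) (k - i) * qpoch q (c * b * q ^+ i) (k - i)).
Proof.
move=> q0 q1 a0 c0 ce0 kK.
have ql0 : q ^+ l != 0 by rewrite expf_neq0.
rewrite askey_wilson_z_swap ?mulf_neq0 // /askey_wilson_z -[RHS]mulrA big_mkord.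
congr (_ * _).
pose G i := dual_weight q (a * b * c * e * q ^+ k / q) (c ^+ 2 * q ^+ l) (c * e) k l i
    * (qpoch q (c * a * q ^+ i) (k - i) * qpoch q (c * b * q ^+ i) (k - i)).
(* Terms beyond [k] vanish through [(q^(-k); q)_i]. *)
have -> : \sum_(i < K) G i = \sum_(i < k.+1) G i.
  rewrite (big_ord_widen K G kK) [RHS]big_mkcond; apply: eq_bigr => i _.
  by case: ltnP => // ki; rewrite /G dual_weight_eq0 ?ki // mul0r.
rewrite mulr_sumr; apply: eq_bigr => -[i /= ik] _.
have eP : c * b * a * e * q ^+ k / q = a * b * c * e * q ^+ k / q by congr (_ * _ / _); ring.
rewrite ltnS in ik; rewrite eP /G /dual_weight.
have -> : c / (c * q ^+ l) = q ^- l by rewrite invfM mulVKf.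
have -> : c * (c * q ^+ l) = c ^+ 2 * q ^+ l by rewrite mulrA.
have eW : qpoch q (c * e) k = qpoch q (c * e) i * qpoch q (c * e * q ^+ i) (k - i).
  by rewrite -{1}(subnKC ik) qpochD.
move: ce0; rewrite eW mulf_eq0 negb_or => /andP[ce0 _].
by field; rewrite ce0 qpochqq_neq0.
Qed.

(** In each factor [c e = alpha_(j+1)^2 / alpha_j^2], so its factorial and the powers of [alpha_j]
    and [A] cancel against the normalization; of the prefactors [c^(-n_j)] only a power of [q]
    remains. *)
Lemma mAW_z_dual {F : fieldType} (q : F) d (n : d.-tuple nat) (z : d.-tuple F)
    (alpha : d.+3.-tuple F) (v : nat -> nat) K :
  let u := nth 0%N n in
  let A := alpha`_d.+1 * alpha`_d.+2 in
  let Y := A / alpha`_0 ^+ 2 in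
    q != 0 -> (forall i, q ^+ i.+1 != 1) ->
    (forall i, (i <= d.+2)%N -> alpha`_i != 0) ->
    (forall i, (i <= d)%N ->
       alpha`_i.+1 * (zext z alpha)`_i = A * q ^+ partial v (d - i)) ->
    (forall i, (i < d)%N -> (u i < K)%N) ->
    mAW_denom q n alpha != 0 ->
  A ^+ psum n d * mAW_z q n z alpha / mAW_denom q n alpha =
  (qpoch q A (partial u d) * qpoch q Y (partial u d))^-1 *
  (\prod_(i < d) \sum_(k < K)
    dual_weight q
      (alpha`_i.+2 ^+ 2 / alpha`_0 ^+ 2 * q ^+ (partial u i + partial u i.+1) / q)
      (A ^+ 2 / alpha`_i.+1 ^+ 2 * q ^+ (partial v (d - i.+1) + partial v (d - i)))
      (alpha`_i.+2 ^+ 2 / alpha`_i.+1 ^+ 2) (u i) (v (d - i.+1)%N) k *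
    (qpoch q (A * q ^+ (partial u i + partial v (d - i.+1) + k)) (u i - k)
     * qpoch q (Y * q ^+ (partial u i + partial v (d - i.+1) + k)) (u i - k)))
  / q ^+ (\sum_(i < d) partial v (d - i.+1) * u i).
Proof.
move=> u A Y q0 q1 al0 hzz hK.
rewrite /mAW_denom -/A -/Y /mAW_z !big_add1 /= !big_mkord.
rewrite /coord /= !psumE -/u.
rewrite mulf_eq0 negb_or => /andP[hAY /prodf_neq0 hW].
have A0 : A != 0 by rewrite mulf_neq0 ?al0.
set S := \prod_(i < d) \sum_(k < K) _.
(* Clearing the product part of the normalization leaves an identity that holds factor by factor. *)
suff E : A ^+ partial u d * \prod_(i < d) askey_wilson_z q (u i) (zext z alpha)`_i
      (alpha`_i.+1 * q ^+ psum n i) (alpha`_i.+1 / alpha`_0 ^+ 2 * q ^+ psum n i)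
      (alpha`_i.+2 / alpha`_i.+1 * (zext z alpha)`_i.+1)
      (alpha`_i.+2 / alpha`_i.+1 / (zext z alpha)`_i.+1) =
    \prod_(i < d) (alpha`_i.+1 ^+ u i
       * qpoch q (alpha`_i.+2 ^+ 2 / alpha`_i.+1 ^+ 2) (u i))
    * S / q ^+ (\sum_(i < d) partial v (d - i.+1) * u i).
  rewrite E; set D := \prod_(i < d) (_ * _).
  have D0 : D != 0 by apply/prodf_neq0 => i _; exact: hW.
  have := expf_neq0 (\sum_(i < d) partial v (d - i.+1) * u i) q0.
  move: (q ^+ _) (qpoch q A _ * _) hAY => x y y0 x0.
  by field; rewrite x0 y0 D0.
rewrite /partial -!prodrXr -!prodfV -!big_split /=; apply: eq_bigr => -[i id] _ /=.
pose a0 := alpha`_0; pose a1 := alpha`_i.+1; pose a2 := alpha`_i.+2.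
have a00 : a0 != 0 by exact: al0.
have a10 : a1 != 0 by exact/al0/leqW/leqW.
have a20 : a2 != 0 by exact/al0/leqW.
pose V := partial v (d - i.+1); pose l := v (d - i.+1)%N.
have eV : partial v (d - i) = (V + l)%N by rewrite partial_sub.
have qV0 : q ^+ V != 0 by rewrite expf_neq0.
(* The two parameters built from [z_(j+1)], [j = i + 1], after inserting
   [alpha_(j+1) z_(j+1) = A q^V]. *)
pose c := A * q ^+ V / a1; pose e := a2 ^+ 2 / (a1 * A * q ^+ V).
have c0 : c != 0 := mulf_neq0 (mulf_neq0 A0 qV0) (invr_neq0 a10).
have z1E : (zext z alpha)`_i.+1 = A * q ^+ V / a2 by rewrite -hzz // mulrC mulKf.
have zE : (zext z alpha)`_i = c * q ^+ l.
  apply: (mulfI a10); rewrite hzz ?(ltnW id) // eV exprD /c.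
  by field.
have cE : a2 / a1 * (zext z alpha)`_i.+1 = c by rewrite z1E /c; field; rewrite a10 a20.
have eE : a2 / a1 / (zext z alpha)`_i.+1 = e.
  by rewrite z1E /e; field; rewrite a10 a20 A0 qV0.
rewrite -/a0 -/a1 -/a2 zE cE eE psumE -/u.
have ceE : c * e = a2 ^+ 2 / a1 ^+ 2 by rewrite /c /e; field; rewrite a10 A0 qV0.
have W0 : qpoch q (c * e) (u i) != 0.
  have := hW (Ordinal id) isT; rewrite mulf_eq0 negb_or ceE => /andP[_].
  exact.
have qN0 : q ^+ partial u i != 0 by rewrite expf_neq0.
have aN0 := mulf_neq0 a10 qN0.
rewrite (askey_wilson_z_dual q (u i) l K _ _ _ _ q0 q1 aN0 c0 W0 (hK i id)).
have eX k : c * (a1 * q ^+ partial u i) * q ^+ k = A * q ^+ (partial u i + V + k).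
  by rewrite !exprD /c; field.
have eY k : c * (a1 / a0 ^+ 2 * q ^+ partial u i) * q ^+ k =
    Y * q ^+ (partial u i + V + k).
  by rewrite !exprD /c /Y -/a0; field; rewrite a00 a10.
have eS : a1 * q ^+ partial u i * (a1 / a0 ^+ 2 * q ^+ partial u i) * c * e * q ^+ u i / q
    = a2 ^+ 2 / a0 ^+ 2 * q ^+ (partial u i + partial u i.+1) / q.
  by rewrite -(mulrA _ c) ceE partialS !exprD; field; rewrite a00 a10 q0.
have eT : c ^+ 2 * q ^+ l = A ^+ 2 / a1 ^+ 2 * q ^+ (V + partial v (d - i)).
  by rewrite eV !exprD /c; field.
rewrite -/V -/l eS eT -ceE.
under [in LHS]eq_bigr => k _ do rewrite eX eY.
have -> : c ^- u i = a1 ^+ u i / A ^+ u i / q ^+ (V * u i).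
  by rewrite /c !exprMn exprVn exprM !invfM invrK mulrC mulrA.
have := expf_neq0 (u i) A0; have := expf_neq0 (V * u i) q0.
move: (q ^+ (V * u i)) (A ^+ u i) (\sum_(k < K) _) => x y t x0 y0.
by field; rewrite x0 y0.
Qed.

(** * The duality over a general field *)

(** The algebraic core, for [q] nonzero and not a root of unity; [r] plays the role of [q^(1/2)].
    Both sides are put in self-dual form, and these agree after reversing the index. *)
Lemma mAW_z_duality {F : fieldType} (q r : F) d (n n' : d.-tuple nat)
    (z z' : d.-tuple F) (alpha alpha' : d.+3.-tuple F) :
  let A := alpha`_d.+1 * alpha`_d.+2 in
  let A' := alpha'`_d.+1 * alpha'`_d.+2 in
    r ^+ 2 = q -> q != 0 -> (forall i, q ^+ i.+1 != 1) ->
    (forall i, (i <= d.+2)%N -> alpha`_i != 0) ->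
    (forall i, (i <= d.+2)%N -> alpha'`_i != 0) ->
    (forall i, (i <= d)%N ->
       alpha`_i.+1 * (zext z alpha)`_i = A * q ^+ psum n' (d - i)) ->
    (forall i, (i < d)%N ->
       z'`_i = alpha`_(d - i).+1 / alpha`_0 * (q ^+ psum n (d - i) / r)) ->
    alpha'`_0 = alpha`_0 ->
    (forall i, (i <= d)%N -> alpha'`_i.+1 = alpha`_0 * A / alpha`_(d - i).+1 * r) ->
    alpha'`_d.+2 = alpha`_1 / alpha`_0 / r ->
    mAW_denom q n alpha != 0 -> mAW_denom q n' alpha' != 0 ->
  A ^+ psum n d * mAW_z q n z alpha / mAW_denom q n alpha =
  A' ^+ psum n' d * mAW_z q n' z' alpha' / mAW_denom q n' alpha'.
Proof.
move=> A A' rq q0 q1 al0 al0' hz hz' e0 ea ea2 hden hden'.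
have r0 : r != 0 by apply: contra_neq q0 => r0; rewrite -rq r0 expr0n.
have a00 : alpha`_0 != 0 by exact: al0.
have A0 : A != 0 by rewrite mulf_neq0 ?al0.
have eA : A' = A.
  by rewrite /A' ea // subnn ea2; field; rewrite r0 a00 al0.
pose u := nth 0%N n; pose v := nth 0%N n'.
pose K := (partial u d + partial v d).+1.
have uK i : (i < d)%N -> (u i < K)%N.
  by move=> id; rewrite ltnS (leq_trans (partial_leq u d i id)) ?leq_addr.
have vK i : (i < d)%N -> (v i < K)%N.
  by move=> id; rewrite ltnS (leq_trans (partial_leq v d i id)) ?leq_addl.
have hzz i : (i <= d)%N ->
    alpha`_i.+1 * (zext z alpha)`_i = A * q ^+ partial v (d - i).
  by move=> id; rewrite hz // psumE.
(* The dual data satisfy the same relation with the roles exchanged; [i = d] is the extra entry of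
   [zext]. *)
have hzz' i : (i <= d)%N ->
    alpha'`_i.+1 * (zext z' alpha')`_i = A' * q ^+ partial u (d - i).
  rewrite /zext nth_rcons size_tuple; case: ltngtP => // [id|->] _; last first.
    by rewrite subnn partial0 mulr1.
  have a0 : alpha`_(d - i).+1 != 0.
    by apply: al0; rewrite ltnS (leq_trans (leq_subr _ _)).
  rewrite ea ?(ltnW id) // hz' // psumE eA -/u.
  by field; rewrite a0 a00 r0.
rewrite (mAW_z_dual q d n z alpha v K) // (mAW_z_dual q d n' z' alpha' u K) //.
rewrite -/A -/A' eA e0 -/u -/v (sum_partial_sym u v).
congr (_ / _).
have hAY (m : d.-tuple nat) (b : d.+3.-tuple F) : mAW_denom q m b != 0 ->
    b`_d.+1 * b`_d.+2 = A -> b`_0 = alpha`_0 ->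
    qpoch q A (partial (nth 0%N m) d)
      * qpoch q (A / alpha`_0 ^+ 2) (partial (nth 0%N m) d) != 0.
  by rewrite /mAW_denom mulf_eq0 negb_or psumE => /andP[h _] <- <-.
have wt0 i k : (i < d)%N -> (u i < k)%N || (v (d - i.+1)%N < k)%N ->
    dual_weight q
      (alpha`_i.+2 ^+ 2 / alpha`_0 ^+ 2 * q ^+ (partial u i + partial u i.+1) / q)
      (A ^+ 2 / alpha`_i.+1 ^+ 2 * q ^+ (partial v (d - i.+1) + partial v (d - i)))
      (alpha`_i.+2 ^+ 2 / alpha`_i.+1 ^+ 2) (u i) (v (d - i.+1)%N) k = 0.
  by move=> _; exact: dual_weight_eq0.
rewrite (prod_sum_qpoch_dual q A (A / alpha`_0 ^+ 2) u v d K (fun i => dual_weight q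
      (alpha`_i.+2 ^+ 2 / alpha`_0 ^+ 2 * q ^+ (partial u i + partial u i.+1) / q)
      (A ^+ 2 / alpha`_i.+1 ^+ 2 * q ^+ (partial v (d - i.+1) + partial v (d - i)))
      (alpha`_i.+2 ^+ 2 / alpha`_i.+1 ^+ 2) (u i) (v (d - i.+1)%N))
  (hAY n alpha hden erefl erefl) (hAY n' alpha' hden' eA e0) wt0).
(* Factor [i] corresponds to the dual factor [d - 1 - i]. *)
congr (_ * _); rewrite [RHS](reindex_inj rev_ord_inj) /=.
apply: eq_bigr => -[i id] _ /=; apply: eq_bigr => k _.
have di : (d - i.+1 < d)%N by rewrite subnSK // leq_subr.
have e1 : (d - (d - i.+1).+1 = i)%N by rewrite subnSK // subKn // ltnW.
have e2 : (d - (d - i.+1) = i.+1)%N by rewrite subKn.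
have e3 : ((d - i.+1).+1 = d - i)%N by rewrite subnSK.
have b1 : alpha`_i.+1 != 0 by exact/al0/leqW/leqW.
have b2 : alpha`_i.+2 != 0 by exact/al0/leqW.
have f1 : alpha'`_(d - i.+1).+1 = alpha`_0 * A / alpha`_i.+2 * r.
  by rewrite ea ?e2 // ltnW.
have f2 : alpha'`_(d - i.+1).+2 = alpha`_0 * A / alpha`_i.+1 * r.
  by rewrite ea // e1.
rewrite e1 e2 f1 f2 e3 dual_weightC.
(* With the degrees swapped, the parameters remain to be matched: [r ^+ 2 = q] from [alpha']
   accounts for the [/ q] in the weight. *)
congr (dual_weight _ _ _ _ _ _ _ * (qpoch _ (_ * q ^+ (_ + _)) _ * qpoch _ (_ * q ^+ (_ + _)) _)).
- rewrite -rq; by field; rewrite ?A0 ?a00 ?b1 ?b2 ?r0.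
- rewrite -rq; by field; rewrite ?A0 ?a00 ?b1 ?b2 ?r0.
- by field; rewrite ?A0 ?a00 ?b1 ?b2 ?r0.
- by rewrite addnC.
- by rewrite addnC.
Qed.

(** * Specialization to complex powers of [q] *)

Theorem theorem5p3 (R : realType) (q : R) (hq0 : 0 < q) (hq1 : q < 1)
    (d : nat) (hd : (1 <= d)%N)
    (n n' z z' : d.-tuple R[i]) (alpha alpha' : d.+3.-tuple R[i])
    (hz : forall j, (1 <= j <= d)%N -> z@_j != 0)
    (hz' : forall j, (1 <= j <= d)%N -> z'@_j != 0)
    (halpha : forall j, (j <= d.+2)%N -> alpha`_j != 0)
    (halpha' : forall j, (j <= d.+2)%N -> alpha'`_j != 0)
    (rel_n' : forall j, (1 <= j <= d)%N ->
       cpow q n'@_j =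
       (alpha`_(d + 1 - j) * (zext z alpha)@_(d + 1 - j))
       / (alpha`_(d + 2 - j) * (zext z alpha)@_(d + 2 - j)))
    (rel_z' : forall j, (1 <= j <= d)%N ->
       z'@_j = alpha`_(d + 2 - j) / alpha`_0
               * cpow q (psum n (d + 1 - j) - 2^-1))
    (rel_alpha'0 : alpha'`_0 = alpha`_0)
    (rel_alpha' : forall j, (1 <= j <= d.+1)%N ->
       alpha'`_j = alpha`_0 * alpha`_d.+1 * alpha`_d.+2 / alpha`_(d + 2 - j)
                   * cpow q 2^-1)
    (rel_alpha'd2 : alpha'`_d.+2 = alpha`_1 / alpha`_0 * cpow q (- 2^-1))
    (* m and m' are the representatives in N_0^d of the classes of n and n' *)
    (m m' : d.-tuple nat)
    (hm : forall j, (1 <= j <= d)%N -> eqmod_period q n@_j (m@_j)%:R)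
    (hm' : forall j, (1 <= j <= d)%N -> eqmod_period q n'@_j (m'@_j)%:R)
    (hden : mAW_denom q%:C m alpha != 0)
    (hden' : mAW_denom q%:C m' alpha' != 0) :
  mAW_hat q%:C m [tuple of [seq half_sum w | w <- z]] alpha =
  mAW_hat q%:C m' [tuple of [seq half_sum w | w <- z']] alpha'.
Proof.
set Q := q%:C.
have Q0 : Q != 0 by rewrite /Q fmorph_eq0 gt_eqF.
have Q1 i : Q ^+ i.+1 != 1.
  by rewrite /Q -rmorphXn fmorph_eq1 lt_eqF // exprn_ilt1 // ltW.
have cpow_repr (w : R[i]) (k : nat) : eqmod_period q w k%:R -> cpow q w = Q ^+ k.
  by move=> /(cpow_eqmod hq0 hq1) ->; rewrite cpow_nat.
have cpow0 : cpow q (0 : R[i]) = 1 by rewrite (cpow_nat 0).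
pose r : R[i] := cpow q 2^-1.
have rQ : r ^+ 2 = Q.
  have h2 : 2^-1 + 2^-1 = 1%:R :> R[i] by rewrite -[LHS]mulr2n -[LHS]mulr_natl mulfV ?pnatr_eq0.
  by rewrite expr2 -cpowD h2 cpow_nat.
have rV : cpow q (- 2^-1) = r^-1.
  have h : cpow q (- 2^-1) * r = 1 by rewrite -cpowD addNr.
  have r0 : r != 0 by apply: contra_neq Q0 => r0; rewrite -rQ r0 expr0n.
  by apply: (mulIf r0); rewrite h mulVf.
(* [q^(N_k)] depends only on the classes of the [n_j], so their representatives may be used. *)
have psumQ k : (k <= d)%N -> cpow q (psum n k) = Q ^+ psum m k.
  elim: k => [|k IH] kd; first by rewrite /psum !big_geq // cpow0.
  rewrite psumE partialS -psumE exprD -IH ?(ltnW kd) //.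
  by rewrite /psum big_nat_recr //= cpowD (cpow_repr _ _ (hm k.+1 _)).
rewrite /mAW_hat !mAW_half_sum //.
(* The relations for [n'] fix quotients only; they telescope down from [z_(d+1) = alpha_(d+2)], the
   case [k = 0]. *)
have hzz k : (k <= d)%N -> alpha`_(d - k).+1 * (zext z alpha)`_(d - k) =
    alpha`_d.+1 * alpha`_d.+2 * Q ^+ psum m' k.
  elim: k => [|k IH] kd.
    by rewrite subn0 psumE partial0 mulr1 /zext nth_rcons size_tuple ltnn eqxx.
  have := rel_n' k.+1 kd; rewrite (cpow_repr _ _ (hm' k.+1 kd)) addn1 addn2 !subSS.
  rewrite (subSn (ltnW kd)) /coord /= (IH (ltnW kd)) -(subnSK kd) /= => h.
  have Y0 : alpha`_d.+1 * alpha`_d.+2 * Q ^+ psum m' k != 0.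
    by rewrite !mulf_neq0 ?halpha ?expf_neq0.
  rewrite psumE partialS -psumE exprD mulrA.
  by apply: (mulIf (invr_neq0 Y0)); rewrite -h mulrAC mulfV // mul1r.
apply: (@mAW_z_duality _ _ r) => //.
- by move=> i id; rewrite -{1 2}(subKn id) hzz // leq_subr.
- move=> i id; have := rel_z' i.+1 id.
  rewrite addn1 addn2 !subSS cpowD psumQ ?leq_subr // rV /coord /=.
  by rewrite subSn // ltnW.
- move=> i id; rewrite rel_alpha' ?ltnS // addn2 subSS subSn //.
  by rewrite !mulrA.
- by rewrite rel_alpha'd2 rV.
Qed.
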